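(* Let $F\subset\mathbb{R}^d$ be a compact convex set with $0\in\operatorname{int}(F)$, let $m\ge 2$, $2\le k\le m$, $I=\{1,\dots,m\}$, and let $\Omega^1,\dots,\Omega^m\subset\mathbb{R}^d$ be nonempty compact sets which are pairwise disjoint, i.e. $\Omega^i\cap\Omega^p=\emptyset$ for all $i,p\in I$ with $i\ne p$. Then the global optimal solution set $S_k$ is compact. Moreover, for any $x=(x^1,\dots,x^k)\in S_k$, any $i\in I$ and any $\omega^i\in\Omega^i$, one has $$x^j\in\Omega^i[r^i]\quad\text{for all }j\in\{1,\dots,k\},$$ where $$r^{i}=(\|F\|\,\|F^\circ\|)^2\left(\sum_{p\in I}T_F(\omega^{i},\Omega^p)+\frac{\max\{T_F(\omega^{i},\omega)\mid\omega\in\bigcup_{p\in I}\Omega^p\}}{\|F\|\,\|F^\circ\|}\right).$$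
   Context: $\mathbb{R}^d$ ($d\ge1$) carries the Euclidean norm $\|\cdot\|$. $F^\circ=\{y\in\mathbb{R}^d\mid\langle y,x\rangle\le1\ \text{for all }x\in F\}$ is the polar of $F$; $\|F\|=\sup\{\|x\|\mid x\in F\}$ and $\|F^\circ\|=\sup\{\|y\|\mid y\in F^\circ\}$. For a nonempty set $\Omega\subset\mathbb{R}^d$ the minimal time function is $T_F(x,\Omega)=\inf\{t\ge 0\mid (x+tF)\cap\Omega\neq\emptyset\}$; $T_F(x,\omega)$ means $T_F(x,\{\omega\})$. For $r>0$ the enlargement is $\Omega[r]=\{x\in\mathbb{R}^d\mid T_F(x,\Omega)\le r\}$. For $x=(x^1,\dots,x^k)\in(\mathbb{R}^d)^k=\mathbb{R}^{dk}$, $f_k(x)=\sum_{i=1}^m\min_{1\le j\le k}T_F(x^j,\Omega^i)$, and $S_k=\{y\in\mathbb{R}^{dk}\mid f_k(y)=\min_{x\in\mathbb{R}^{dk}}f_k(x)\}$. *)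

(* Defs.v *)
From HB Require Import structures.
From mathcomp Require Import all_boot all_order all_algebra.
From mathcomp Require Import all_classical all_reals all_analysis.
Set Implicit Arguments.
Unset Strict Implicit.
Unset Printing Implicit Defensive.
Import Order.TTheory GRing.Theory Num.Theory.
Import numFieldNormedType.Exports.
Local Open Scope classical_set_scope.
Local Open Scope ring_scope.

(* R^d is 'rV[R]_d and (R^d)^k is 'M[R]_(k, d), with x^j = row j x. Their
   library topology is the product one, i.e. the Euclidean topology; but the
   library norm `|x| is the sup norm, hence the explicit Euclidean norm below.
   [sup] and [inf] are the real-valued library ones, equal to 0 on the empty
   set or when unbounded: the notions below have their usual meaning when F is
   bounded with 0 in its interior, Omega is nonempty and k is positive. *)

Definition dotr (R : realType) (d : nat) (x y : 'rV[R]_d) : R :=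
  \sum_(l < d) x 0 l * y 0 l.

Definition eucl_norm (R : realType) (d : nat) (x : 'rV[R]_d) : R :=
  Num.sqrt (dotr x x).

Definition polar (R : realType) (d : nat) (F : set 'rV[R]_d) : set 'rV[R]_d :=
  [set y | forall x, F x -> dotr y x <= 1].

Definition set_norm (R : realType) (d : nat) (F : set 'rV[R]_d) : R :=
  sup [set eucl_norm x | x in F].

Definition min_time (R : realType) (d : nat) (F : set 'rV[R]_d)
    (x : 'rV[R]_d) (Omega : set 'rV[R]_d) : R :=
  inf [set t : R | 0 <= t /\ [set x + t *: v | v in F] `&` Omega !=set0].

Definition enlargement (R : realType) (d : nat) (F Omega : set 'rV[R]_d)
    (r : R) : set 'rV[R]_d :=
  [set x | min_time F x Omega <= r].

(* The infimum over j ranges over a finite set of values, so it is the minimum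
   when 0 < k. *)
Definition objective (R : realType) (d m k : nat) (F : set 'rV[R]_d)
    (Omega : 'I_m -> set 'rV[R]_d) (x : 'M[R]_(k, d)) : R :=
  \sum_(i < m) inf [set min_time F (row j x) (Omega i) | j in [set: 'I_k]].

Definition solution_set (R : realType) (d m k : nat) (F : set 'rV[R]_d)
    (Omega : 'I_m -> set 'rV[R]_d) : set 'M[R]_(k, d) :=
  [set y | forall x : 'M[R]_(k, d), objective F Omega y <= objective F Omega x].
Arguments solution_set {R d m} k F Omega.

(* Main.v *)
(* Write rho for the gauge of F, so that T_F(x, {v}) = rho(v - x). Then
   rho <= ||F°|| ||.|| (bipolar theorem) and ||.|| <= ||F|| rho, so that
   rho(-v) <= c rho(v) with c = ||F|| ||F°|| >= 1.
   At an optimum every x^j is the closest component to some Omega^p: otherwise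
   dropping x^j costs nothing, and it can be moved onto a set that the k - 1 < m
   others do not meet. Hence T_F(x^j, Omega^p) <= f_k(x) <= f_k(w, ..., w), and
   the triangle inequality through a nearly closest v in Omega^p gives
   T_F(x^j, Omega^i) <= sum_p T_F(w, Omega^p) + rho(w - v), which is at most r^i.
   The solution set is therefore bounded; it is closed because f_k is
   Lipschitz. *)
Require Import Defs.
From HB Require Import structures.
From mathcomp Require Import all_boot all_order all_algebra.
From mathcomp Require Import all_classical all_reals all_analysis.
From mathcomp Require Import ring lra.
Set Implicit Arguments.
Unset Strict Implicit.
Unset Printing Implicit Defensive.
Import Order.TTheory GRing.Theory Num.Theory.
Import numFieldNormedType.Exports.
Local Open Scope classical_set_scope.
Local Open Scope ring_scope.

(** * The Euclidean inner product and norm, compared with the sup norm *)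

Section EuclideanNorm.
Variables (R : realType) (d : nat).
Implicit Types (x y z : 'rV[R]_d) (a : R).

Lemma dotrC x y : dotr x y = dotr y x.
Proof. by apply: eq_bigr => l _; rewrite mulrC. Qed.

Lemma dotrDr x y z : dotr x (y + z) = dotr x y + dotr x z.
Proof. by rewrite -big_split; apply: eq_bigr => l _; rewrite mxE mulrDr. Qed.

Lemma dotrZr a x y : dotr x (a *: y) = a * dotr x y.
Proof. by rewrite mulr_sumr; apply: eq_bigr => l _; rewrite mxE mulrCA. Qed.

Lemma dotrNr x y : dotr x (- y) = - dotr x y.
Proof. by rewrite -scaleN1r dotrZr mulN1r. Qed.

Lemma dotrDl x y z : dotr (x + y) z = dotr x z + dotr y z.
Proof. by rewrite dotrC dotrDr !(dotrC z). Qed.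

Lemma dotrZl a x y : dotr (a *: x) y = a * dotr x y.
Proof. by rewrite dotrC dotrZr dotrC. Qed.

Lemma dotrNl x y : dotr (- x) y = - dotr x y.
Proof. by rewrite dotrC dotrNr dotrC. Qed.

Lemma dotr0 x : dotr x 0 = 0.
Proof. by rewrite -(scale0r 0) dotrZr mul0r. Qed.

Lemma dotr_ge0 x : 0 <= dotr x x.
Proof. by apply: sumr_ge0 => l _; rewrite -expr2 sqr_ge0. Qed.

Lemma eucl_norm_ge0 x : 0 <= eucl_norm x.
Proof. exact: sqrtr_ge0. Qed.

Lemma sqr_eucl_norm x : eucl_norm x ^+ 2 = dotr x x.
Proof. by rewrite sqr_sqrtr ?dotr_ge0. Qed.

Lemma eucl_normZ a x : eucl_norm (a *: x) = `|a| * eucl_norm x.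
Proof.
by rewrite /eucl_norm dotrZl dotrZr mulrA -expr2 sqrtrM ?sqr_ge0// sqrtr_sqr.
Qed.

Lemma eucl_normN x : eucl_norm (- x) = eucl_norm x.
Proof. by rewrite -scaleN1r eucl_normZ normrN1 mul1r. Qed.

Lemma eucl_normB x y : eucl_norm (x - y) = eucl_norm (y - x).
Proof. by rewrite -eucl_normN opprB. Qed.

Lemma coord_le_norm k (A : 'M[R]_(k, d)) i j : `|A i j| <= `|A|.
Proof.
rewrite [leRHS]/Num.norm /= mx_normrE.
exact: (le_bigmax _ (fun ij => `|A ij.1 ij.2|) (i, j)).
Qed.

Lemma mx_norm_le k (A : 'M[R]_(k, d)) a : 0 <= a ->
  (forall i j, `|A i j| <= a) -> `|A| <= a.
Proof.
move=> a0 Aa; rewrite [leLHS]/Num.norm /= mx_normrE.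
by apply/bigmax_leP; split=> // -[i j] _; exact: Aa.
Qed.

Lemma norm_le_eucl_norm x : `|x| <= eucl_norm x.
Proof.
apply: mx_norm_le => [|i j]; first exact: eucl_norm_ge0.
rewrite -sqrtr_sqr ler_sqrt ?dotr_ge0// (ord1 i) /dotr (bigD1 j)//= -expr2 lerDl.
by apply: sumr_ge0 => l _; rewrite -expr2 sqr_ge0.
Qed.

Lemma eucl_norm_le_norm x : eucl_norm x <= Num.sqrt d%:R * `|x|.
Proof.
rewrite -(normr_id x) -sqrtr_sqr -sqrtrM ?ler0n// ler_sqrt; last first.
  by rewrite mulr_ge0 ?ler0n ?sqr_ge0.
have -> : d%:R * `|x| ^+ 2 = \sum_(l < d) `|x| ^+ 2.
  by rewrite sumr_const card_ord mulr_natl.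
apply: ler_sum => l _; rewrite -expr2 -[leLHS]real_normK ?num_real//.
by rewrite lerXn2r ?nnegrE// coord_le_norm.
Qed.

Lemma eucl_norm_eq0 x : eucl_norm x = 0 -> x = 0.
Proof.
move=> x0; apply/eqP; rewrite -normr_eq0 eq_le normr_ge0 andbT.
by rewrite -x0 norm_le_eucl_norm.
Qed.

(** Cauchy-Schwarz: with a = ||x||, b = ||y|| and p = <x, y>, the vector b^2 x - p y has squared
    norm b^2 ((a b)^2 - p^2), which is nonnegative. *)
Lemma dotr_le_eucl_norm x y : dotr x y <= eucl_norm x * eucl_norm y.
Proof.
have [->|y0] := eqVneq y 0; first by rewrite dotr0 mulr_ge0 ?eucl_norm_ge0.
have ny0 : 0 < eucl_norm y.
  by rewrite lt_def eucl_norm_ge0 andbT; apply: contraNneq y0 => /eucl_norm_eq0->.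
have := dotr_ge0 (eucl_norm y ^+ 2 *: x - dotr x y *: y).
rewrite !(dotrDl, dotrDr, dotrNl, dotrNr, dotrZl, dotrZr) (dotrC y x).
rewrite -!sqr_eucl_norm; set p := dotr x y; set a := eucl_norm x.
set b := eucl_norm y in ny0 *.
rewrite [leRHS](_ : _ = b ^+ 2 * ((a * b) ^+ 2 - p ^+ 2)); last by ring.
rewrite pmulr_rge0 ?exprn_gt0// subr_ge0 => pab.
apply: le_trans (ler_norm p) _.
by rewrite -ler_sqr ?nnegrE ?mulr_ge0 ?eucl_norm_ge0// real_normK ?num_real.
Qed.

(** Provides the nearest point of a compact set; the squared distance is a polynomial in the
    coordinates. *)
Lemma continuous_dotr_sub v : continuous (fun x => dotr (v - x) (v - x)).
Proof.
rewrite (_ : (fun _ => _) =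
    (fun x => \sum_(l < d) (v 0 l - x 0 l) * (v 0 l - x 0 l))).
  apply: continuous_big => [|l _ x]; first exact: add_continuous.
  have c : v 0 l - y 0 l @[y --> x] --> v 0 l - x 0 l.
    by apply: cvgB; [exact: cvg_cst | exact: coord_continuous].
  exact: (cvgM c c).
by apply/funext => x; apply: eq_bigr => l _; rewrite !mxE.
Qed.

End EuclideanNorm.

(** * Strict separation of a point from a compact convex set *)

Section Separation.
Variables (R : realType) (d : nat) (F : set 'rV[R]_d).

Lemma convex_setP (x y : 'rV[R]_d) (a b : R) : convex_set F ->
  F x -> F y -> 0 <= a -> 0 <= b -> a + b = 1 -> F (a *: x + b *: y).
Proof.
move=> cF Fx Fy a0 b0 ab1.
have a1 : a <= 1 by rewrite -ab1 lerDl.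
have := cF x y (Itv01 a0 a1); rewrite !inE => /(_ Fx Fy).
by rewrite /conv /= /isConvexSpace.conv /= /unstable.onem /= -ab1 addrAC subrr add0r.
Qed.

(** The normal is v - p, where p is a point of [F] nearest to v, and the level is its value at p. *)
Lemma strict_separation (v : 'rV[R]_d) : F !=set0 -> compact F ->
  convex_set F -> ~ F v ->
  exists y a, (forall x, F x -> dotr y x <= a) /\ a < dotr y v.
Proof.
move=> F0 cF convF Fv.
have [p /[!inE] Fp pmin] := compact_EVT_min F0 cF
  (continuous_subspaceT (@continuous_dotr_sub R d v)).
exists (v - p), (dotr (v - p) p); split => [x Fx|]; last first.
  rewrite -subr_gt0 -dotrNr -dotrDr -sqr_eucl_norm exprn_gt0//.
  rewrite lt_def eucl_norm_ge0 andbT; apply/eqP => /eucl_norm_eq0/eqP.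
  by rewrite subr_eq0 => /eqP vp; apply: Fv; rewrite vp.
rewrite -subr_le0 -dotrNr -dotrDr.
set q := dotr (v - p) (x - p).
(* First-order condition at p: the point p + s (x - p) of [F] is no closer to v than p. Expanding
   the squares and dividing by s gives the bound. *)
have key s : 0 < s -> s <= 1 -> 2 * q <= s * dotr (x - p) (x - p).
  move=> s0 s1.
  have Fz : F (s *: x + (1 - s) *: p).
    by apply: convex_setP => //; [exact: ltW | rewrite subr_ge0 | ring].
  have := pmin (s *: x + (1 - s) *: p); rewrite inE => /(_ Fz).
  have -> : v - (s *: x + (1 - s) *: p) = (v - p) - s *: (x - p).
    by apply/rowP => l; rewrite !mxE; ring.
  rewrite /q; move: (v - p) (x - p) => u w.
  rewrite [leRHS](_ : _ = dotr u u + s * (s * dotr w w - 2 * dotr u w)).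
    by rewrite lerDl pmulr_rge0// subr_ge0.
  by rewrite !(dotrDl, dotrDr, dotrNl, dotrNr, dotrZl, dotrZr) (dotrC w u); ring.
rewrite leNgt; apply/negP => q0.
have n0 := dotr_ge0 (x - p); set n := dotr _ _ in n0 key.
(* If q > 0, this s makes the right-hand side at most q, against 2 q. The minimum keeps s <= 1, and
   n + 1 avoids a zero denominator. *)
have := key (Num.min 1 (q / (n + 1))).
have n1 : 0 < n + 1 by rewrite ltr_wpDl.
rewrite lt_min ltr01 divr_gt0//= ge_min lexx => /(_ isT isT) h.
have : Num.min 1 (q / (n + 1)) * n <= q.
  apply: (@le_trans _ _ (q / (n + 1) * n)).
    by rewrite ler_wpM2r// ge_min lexx orbT.
  by rewrite mulrAC ler_pdivrMr// ler_pM2l// lerDl.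
by move: h; nra.
Qed.

End Separation.

(** * Boundedness of compact sets and of polars *)

Section SetNorm.
Variables (R : realType) (d : nat).
Implicit Types A : set 'rV[R]_d.

Lemma compact_eucl_bounded A : compact A ->
  exists K, forall x, A x -> eucl_norm x <= K.
Proof.
move=> /compact_bounded[M [_ AM]]; exists (Num.sqrt d%:R * (M + 1)) => x Ax.
apply: le_trans (eucl_norm_le_norm x) _.
by rewrite ler_wpM2l ?sqrtr_ge0//; apply: AM; rewrite ?ltrDl.
Qed.

Lemma eucl_norm_le_set_norm A K : (forall x, A x -> eucl_norm x <= K) ->
  forall x, A x -> eucl_norm x <= set_norm A.
Proof.
move=> AK x Ax; apply: ub_le_sup; last by exists x.
by exists K => _ [y Ay <-]; exact: AK.
Qed.

(** Testing y against the vector of norm e / 2 in its own direction, which lies in a ball inside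
    [A], gives ||y|| e / 2 <= 1. Hence the [sup] defining the norm of the polar is a true
    supremum. *)
Lemma polar_bounded A : interior A 0 ->
  exists K, forall y, polar A y -> eucl_norm y <= K.
Proof.
move=> /nbhs_ballP[e /= e0 eA]; exists (2 / e) => y Ay.
have [->|y0] := eqVneq (eucl_norm y) 0; first by rewrite divr_ge0// ltW.
have ny0 : 0 < eucl_norm y by rewrite lt_def y0 eucl_norm_ge0.
have /Ay : A ((e / 2 / eucl_norm y) *: y).
  apply: eA; rewrite -ball_normE /ball_ /= sub0r normrN.
  apply: le_lt_trans (norm_le_eucl_norm _) _.
  rewrite eucl_normZ ger0_norm; last by rewrite !divr_ge0 ?ltW.
  by rewrite divfK// ltr_pdivrMr// ltr_pMr// ltr1n.
rewrite dotrZr -sqr_eucl_norm expr2 mulrA divfK// => h.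
by rewrite ler_pdivlMr// mulrC; move: h; rewrite mulrAC ler_pdivrMr// mul1r.
Qed.

End SetNorm.

(** * Estimates for the minimal time function *)

Section MinTime.
Variables (R : realType) (d : nat) (F : set 'rV[R]_d).
Hypotheses (d_gt0 : (0 < d)%N) (F_compact : compact F)
  (F_convex : convex_set F) (F_int0 : interior F 0).
Implicit Types (x y v w : 'rV[R]_d) (t : R) (Omega : set 'rV[R]_d).

Let N := set_norm F.
Let P := set_norm (polar F).

Lemma F0 : F 0.
Proof. exact: interior_subset F_int0. Qed.

Lemma le_normF x : F x -> eucl_norm x <= N.
Proof.
have [K FK] := compact_eucl_bounded F_compact.
by move=> Fx; apply: eucl_norm_le_set_norm FK _ Fx.
Qed.

Lemma le_normP y : polar F y -> eucl_norm y <= P.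
Proof.
have [K FK] := polar_bounded F_int0.
by move=> Fy; apply: eucl_norm_le_set_norm FK _ Fy.
Qed.

Lemma normF_ge0 : 0 <= N.
Proof. exact: le_trans (eucl_norm_ge0 0) (le_normF F0). Qed.

Lemma exists_eucl_norm_gt0 : exists u : 'rV[R]_d, 0 < eucl_norm u.
Proof.
exists (const_mx 1); rewrite lt_def eucl_norm_ge0 andbT.
apply/eqP => /eucl_norm_eq0/rowP/(_ (Ordinal d_gt0)); rewrite !mxE => /eqP.
by rewrite oner_eq0.
Qed.

(** Since [F] is bounded, a small multiple of any nonzero vector lies in the polar. Positivity of
    [N] is deduced from this lemma only later, hence the use of N + 1. *)
Lemma normP_gt0 : 0 < P.
Proof.
have [u u0] := exists_eucl_norm_gt0.
have N1 : 0 < N + 1 by rewrite ltr_wpDl// normF_ge0.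
pose s := (eucl_norm u * (N + 1))^-1.
have s0 : 0 < s by rewrite invr_gt0 mulr_gt0.
have Psu : polar F (s *: u).
  move=> x Fx; rewrite dotrZl mulrC ler_pdivrMr ?mulr_gt0// mul1r.
  apply: le_trans (dotr_le_eucl_norm _ _) _.
  by rewrite ler_wpM2l ?eucl_norm_ge0// (le_trans (le_normF Fx))// lerDl.
by apply: lt_le_trans (le_normP Psu); rewrite eucl_normZ mulr_gt0// normr_gt0 gt_eqF.
Qed.

(* A point outside F is separated from F by some y in the polar, hence has norm
   above 1 / P. *)
Lemma scaled_mem v t : P * eucl_norm v <= t -> exists2 f, F f & v = t *: f.
Proof.
move=> Pvt; have t0 : 0 <= t.
  by apply: le_trans Pvt; rewrite mulr_ge0 ?eucl_norm_ge0// ltW// normP_gt0.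
have [t_0|tn0] := eqVneq t 0.
  exists 0; first exact: F0.
  rewrite scaler0; apply: eucl_norm_eq0; apply/eqP; rewrite eq_le eucl_norm_ge0.
  by rewrite andbT -(pmulr_rle0 _ normP_gt0) -t_0.
have {t0 tn0} t0 : 0 < t by rewrite lt_def tn0.
exists (t^-1 *: v); last by rewrite scalerA divff ?scale1r// gt_eqF.
apply: contrapT => Fv.
have [y [a [ya av]]] := strict_separation (ex_intro _ 0 F0) F_compact F_convex Fv.
have a0 : 0 <= a by rewrite -(dotr0 y); apply: ya; exact: F0.
(* The level [a] may be 0, so [y] is scaled into the polar by a larger level that still
   separates. *)
pose b := (a + dotr y (t^-1 *: v)) / 2.
have ab : a < b by rewrite /b; lra.
have bv : b < dotr y (t^-1 *: v) by rewrite /b; lra.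
have b0 : 0 < b by exact: le_lt_trans ab.
have Py : polar F (b^-1 *: y).
  move=> x Fx; rewrite dotrZl mulrC ler_pdivrMr// mul1r.
  by apply: le_trans (ya _ Fx) (ltW ab).
have := bv; rewrite dotrZr mulrC ltr_pdivlMr// => h.
have := dotr_le_eucl_norm (b^-1 *: y) v; rewrite dotrZl => h1.
have h2 : eucl_norm (b^-1 *: y) * eucl_norm v <= t.
  by apply: le_trans Pvt; rewrite ler_wpM2r ?eucl_norm_ge0// le_normP.
have := le_trans h1 h2; rewrite mulrC ler_pdivrMr// => h3.
by move: (lt_le_trans h h3); rewrite mulrC ltxx.
Qed.

(** Writing u = P ||u|| f with f in [F] and taking norms gives ||u|| <= P ||u|| N. *)
Lemma normFP_ge1 : 1 <= N * P.
Proof.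
have [u u0] := exists_eucl_norm_gt0.
have [f Ff uf] := scaled_mem (lexx (P * eucl_norm u)).
rewrite -(ler_pM2r u0) mul1r {1}uf eucl_normZ ger0_norm; last first.
  by rewrite mulr_ge0 ?eucl_norm_ge0// ltW// normP_gt0.
rewrite [leRHS](_ : _ = P * eucl_norm u * N); last by ring.
by rewrite ler_wpM2l ?le_normF// mulr_ge0 ?eucl_norm_ge0// ltW// normP_gt0.
Qed.

Lemma normF_gt0 : 0 < N.
Proof. by rewrite -(pmulr_lgt0 _ normP_gt0) (lt_le_trans ltr01)// normFP_ge1. Qed.

Lemma min_time_le x Omega t f : 0 <= t -> F f -> Omega (x + t *: f) ->
  min_time F x Omega <= t.
Proof.
move=> t0 Ff Of; apply: ge_inf; first by exists 0 => s [].
by split => //; exists (x + t *: f); split => //; exists f.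
Qed.

Lemma min_time_le_norm x Omega v : Omega v ->
  min_time F x Omega <= P * eucl_norm (v - x).
Proof.
move=> Ov; have [f Ff vx] := scaled_mem (lexx (P * eucl_norm (v - x))).
apply: (min_time_le _ Ff); last by rewrite -vx addrC subrK.
by rewrite mulr_ge0 ?eucl_norm_ge0// ltW// normP_gt0.
Qed.

(** Near-optimal times suffice for all later estimates. They exist because [scaled_mem] makes the
    set of admissible times nonempty, so that [inf] is a true infimum. *)
Lemma min_time_adherent x Omega e : Omega !=set0 -> 0 < e ->
  exists t f, [/\ 0 <= t, t < min_time F x Omega + e, F f & Omega (x + t *: f)].
Proof.
move=> [v Ov] e0.
have [|t [t0 [_ [[f Ff <-] Oxf]]] te] := @inf_adherent R
    [set t : R | 0 <= t /\ [set x + t *: v | v in F] `&` Omega !=set0] e e0.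
  split; last by exists 0 => s [].
  have [f Ff vx] := scaled_mem (lexx (P * eucl_norm (v - x))).
  exists (P * eucl_norm (v - x)); split.
    by rewrite mulr_ge0 ?eucl_norm_ge0// ltW// normP_gt0.
  by exists v; split => //; exists f => //; rewrite -vx addrC subrK.
by exists t, f.
Qed.

Lemma min_time_ge0 x Omega : Omega !=set0 -> 0 <= min_time F x Omega.
Proof.
move=> O0; apply/ler_addgt0Pr => e e0.
by have [t [f [t0 te _ _]]] := min_time_adherent x O0 e0; exact: le_trans (ltW te).
Qed.

Lemma min_time_mem x Omega : Omega x -> min_time F x Omega <= 0.
Proof.
by move=> Ox; apply: (@min_time_le _ _ _ 0) F0 _; rewrite ?scale0r ?addr0.
Qed.

(** A time below e / N moves x by less than e, so points of [Omega] lie arbitrarily close to x. *)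
Lemma min_time_le0 x Omega : Omega !=set0 -> closed Omega ->
  min_time F x Omega <= 0 -> Omega x.
Proof.
move=> O0 cO T0; apply: cO => B /nbhs_ballP[e /= e0 eB].
have eN : 0 < e / N by rewrite divr_gt0// normF_gt0.
have [t [f [t0 te Ff Oxf]]] := min_time_adherent x O0 eN.
exists (x + t *: f); split => //; apply: eB; rewrite -ball_normE /ball_ /=.
rewrite opprD addrA subrr sub0r normrN.
apply: le_lt_trans (norm_le_eucl_norm _) _; rewrite eucl_normZ ger0_norm//.
apply: (@le_lt_trans _ _ (t * N)); first by rewrite ler_wpM2l// le_normF.
by rewrite -ltr_pdivlMr ?normF_gt0//; apply: lt_le_trans te _; rewrite gerDr.
Qed.

(** Triangle inequality, from convexity: t f + s g is (t + s) times a convex combination of f and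
    g. *)
Lemma min_time_add x Omega t f : 0 <= t -> F f -> Omega !=set0 ->
  min_time F x Omega <= t + min_time F (x + t *: f) Omega.
Proof.
move=> t0 Ff O0; apply/ler_addgt0Pr => e e0.
have [s [g [s0 se Fg Og]]] := min_time_adherent (x + t *: f) O0 e0.
apply: (@le_trans _ _ (t + s)); last by rewrite -addrA lerD2l ltW.
(* The weights t / (t + s) and s / (t + s) need t + s <> 0; otherwise t = 0 and the first move is
   void. *)
have [ts0|ts0] := eqVneq (t + s) 0.
  have t_0 : t = 0 by apply/eqP; rewrite eq_le t0 andbT -ts0 lerDl.
  by rewrite t_0 scale0r addr0 in Og *; rewrite add0r; exact: min_time_le Og.
have ts : 0 < t + s by rewrite lt_def ts0 addr_ge0.
apply: (@min_time_le _ _ _ ((t / (t + s)) *: f + (s / (t + s)) *: g)).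
- exact: ltW.
- by apply: convex_setP => //; rewrite ?divr_ge0 ?(ltW ts)// -mulrDl divff.
- rewrite scalerDr !scalerA (mulrC _ (t / _)) (mulrC _ (s / _)) !divfK//.
  by rewrite addrA.
Qed.

(** First move from x to y, in time P ||y - x||; the factor sqrt d passes to the sup norm. *)
Lemma min_time_lip x y Omega : Omega !=set0 ->
  min_time F x Omega <= min_time F y Omega + P * Num.sqrt d%:R * `|x - y|.
Proof.
move=> O0; have [f Ff yx] := scaled_mem (lexx (P * eucl_norm (y - x))).
have P0 : 0 <= P * eucl_norm (y - x).
  by rewrite mulr_ge0 ?eucl_norm_ge0// ltW// normP_gt0.
apply: le_trans (min_time_add x P0 Ff O0) _.
rewrite -yx (addrC x) subrK addrC lerD2l -mulrA ler_wpM2l// ?(ltW normP_gt0)//.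
by rewrite distrC eucl_norm_le_norm.
Qed.

(** A move of duration t along an element of [F] has length at most t N. *)
Lemma eucl_norm_le_min_time w v : eucl_norm (v - w) <= N * min_time F w [set v].
Proof.
rewrite -ler_pdivrMl ?normF_gt0//; apply/ler_addgt0Pr => e e0.
have v0 : [set v] !=set0 by exists v.
have [t [f [t0 te Ff /= wv]]] := min_time_adherent w v0 e0.
rewrite -{1}wv (addrC w) addrK; apply: le_trans (ltW te).
rewrite ler_pdivrMl ?normF_gt0// eucl_normZ ger0_norm// mulrC.
by rewrite ler_wpM2r// le_normF.
Qed.

End MinTime.

(** * Compactness in matrix space, finite minima and a pigeonhole argument *)

(** The row-vector case is carried over by [vec_mx], which does not increase the sup norm and is
    therefore continuous. *)
Lemma bounded_closed_compact_mx (R : realType) (k d : nat)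
    (A : set 'M[R]_(k, d)) M :
  (forall x, A x -> `|x| <= M) -> closed A -> compact A.
Proof.
move=> AM Acl.
have vec_le (u : 'rV[R]_(k * d)) : `|vec_mx u| <= `|u|.
  by apply: mx_norm_le => // i j; rewrite mxE coord_le_norm.
have vec_cont : continuous (@vec_mx R k d).
  move=> u B /nbhs_ballP[e e0 eB]; apply/nbhs_ballP; exists e => // v.
  rewrite -ball_normE /ball_ /= => uv; apply: eB; rewrite -ball_normE /ball_ /=.
  by rewrite -raddfB; exact: le_lt_trans (vec_le _) uv.
have -> : A = [set vec_mx u | u in vec_mx @^-1` A].
  by apply/seteqP; split=> [x Ax|_ [u Au <-]//]; exists (mxvec x); rewrite /= mxvecK.
apply: continuous_compact; first exact: continuous_subspaceT.
apply: bounded_closed_compact; last by apply: closed_comp => // u _; exact: vec_cont.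
exists `|M|; split; first exact: num_real.
move=> K MK u /= /AM uM; apply: mx_norm_le => [|i j].
  by apply: ltW; apply: le_lt_trans MK.
rewrite (ord1 i) -[u]vec_mxK; case/mxvec_indexP: j => a b; rewrite mxvecE.
apply: le_trans (coord_le_norm _ _ _) _; apply: le_trans uM _.
by rewrite ltW// (le_lt_trans (ler_norm M)).
Qed.

Lemma inf_le_finite (R : realType) (k : nat) (g : 'I_k -> R) j :
  inf [set g l | l in [set: 'I_k]] <= g j.
Proof.
apply: ge_inf; last by exists j.
case: (@arg_minP _ _ _ j xpredT g) => // l _ gl.
by exists (g l) => _ [i _ <-]; exact: gl.
Qed.

Lemma inf_attained_finite (R : realType) (k : nat) (g : 'I_k -> R) : (0 < k)%N ->
  exists j, g j <= inf [set g l | l in [set: 'I_k]].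
Proof.
move=> k0; case: (@arg_minP _ _ _ (Ordinal k0) xpredT g) => // l _ gl.
exists l; apply: lb_le_inf; first by exists (g l), l.
by move=> _ [i _ <-]; exact: gl.
Qed.

(** Injectivity gives m <= k, and equality fails because the image lies among the k - 1 indices
    other than [j]. *)
Lemma injective_avoid_leq (m k : nat) (s : 'I_m -> 'I_k) (j : 'I_k) :
  injective s -> (forall q, s q != j) -> (m < k)%N.
Proof.
move=> s_inj sj; have := max_card (mem (codom s)); rewrite card_codom//.
rewrite !card_ord leq_eqVlt => /orP[/eqP mk|//].
have: (#|codom s| <= #|predC1 j|)%N.
  by apply/subset_leq_card/fintype.subsetP => _ /codomP[q ->]; rewrite inE sj.
rewrite card_codom// cardC1 !card_ord mk -ltnS prednK ?ltnn//.
exact: leq_ltn_trans (ltn_ord j).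
Qed.

(** * Optimal solutions: closedness, localisation and compactness *)

Section Objective.
Variables (R : realType) (d m k : nat) (F : set 'rV[R]_d)
  (Omega : 'I_m -> set 'rV[R]_d).
Hypotheses (d_gt0 : (0 < d)%N) (k_gt0 : (0 < k)%N) (k_le_m : (k <= m)%N)
  (F_compact : compact F) (F_convex : convex_set F) (F_int0 : interior F 0)
  (Omega_nonempty : forall i, Omega i !=set0)
  (Omega_compact : forall i, compact (Omega i))
  (Omega_disjoint : forall i p, i != p -> Omega i `&` Omega p = set0).
Implicit Types (x y : 'M[R]_(k, d)) (w : 'rV[R]_d).

Let c := set_norm F * set_norm (polar F).
Let cost x i := inf [set min_time F (row j x) (Omega i) | j in [set: 'I_k]].

Lemma cost_ge0 x i : 0 <= cost x i.
Proof.
pose j := Ordinal k_gt0.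
apply: lb_le_inf; first by exists (min_time F (row j x) (Omega i)), j.
by move=> _ [l _ <-]; exact: min_time_ge0.
Qed.

(** For each set, the index attaining the minimum at y serves as a competitor at x. *)
Lemma objective_lip x y : objective F Omega x <= objective F Omega y
  + (set_norm (polar F) * Num.sqrt d%:R * `|x - y|) *+ m.
Proof.
rewrite -[X in _ *+ X]card_ord -sumr_const -big_split; apply: ler_sum => i _ /=.
have [j cj] := inf_attained_finite
  (fun j => min_time F (row j y) (Omega i)) k_gt0.
apply: le_trans (inf_le_finite (fun j => min_time F (row j x) (Omega i)) j) _.
apply: le_trans (min_time_lip d_gt0 F_compact F_convex F_int0 _ (row j y) _) _ => //.
apply: lerD => //; rewrite ler_wpM2l//.
  by rewrite mulr_ge0 ?sqrtr_ge0// ltW// normP_gt0.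
apply: mx_norm_le => // a b; apply: le_trans (coord_le_norm _ j b).
by rewrite !mxE.
Qed.

Lemma closed_solution_set : closed (solution_set k F Omega).
Proof.
move=> y ycl x; set C := set_norm (polar F) * Num.sqrt d%:R.
have C0 : 0 <= C by rewrite mulr_ge0 ?sqrtr_ge0// ltW// normP_gt0.
apply/ler_addgt0Pr => e e0.
have Cm0 : 0 < C *+ m + 1 by rewrite ltr_wpDl// mulrn_wge0.
(* The radius keeps the Lipschitz error below e; the added 1 makes the denominator positive. *)
have [z [Sz yz]] := ycl _ (nbhsx_ballx y (e / (C *+ m + 1)) (divr_gt0 e0 Cm0)).
apply: le_trans (objective_lip y z) _; apply: lerD; first exact: Sz.
move: yz; rewrite -ball_normE /ball_ /= ltr_pdivlMr// => /ltW; apply: le_trans.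
by rewrite -/C -mulrnAl mulrC ler_wpM2l// lerDl.
Qed.

(* Otherwise x^j could be moved for free onto a set that no x^l meets; such a
   set exists because k - 1 < m points cannot meet m disjoint sets. *)
Lemma solution_component_serves x j : solution_set k F Omega x ->
  exists p, min_time F (row j x) (Omega p) <= cost x p.
Proof.
move=> Sx; apply: contrapT => jnot.
have redundant p : exists l, l != j /\ min_time F (row l x) (Omega p) <= cost x p.
  have [l lp] := inf_attained_finite (fun l => min_time F (row l x) (Omega p)) k_gt0.
  exists l; split => //; apply/eqP => lj; apply: jnot; exists p.
  by rewrite -lj.
(* If all costs vanished, each closed [Omega q] would contain some x^l with l <> j. Disjointness
   makes this choice injective, which forces m < k. *)
have [q cq] : exists q, 0 < cost x q.
  apply: contrapT => c0; have [s sP] := choice redundant.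
  have sO q : Omega q (row (s q) x).
    apply: (min_time_le0 d_gt0 F_compact F_convex F_int0) => //.
      by apply: compact_closed => //; exact: norm_hausdorff.
    apply: le_trans (sP q).2 _; rewrite leNgt; apply/negP => cq.
    by apply: c0; exists q.
  have s_inj : injective s.
    move=> p q spq; apply/eqP/negPn/negP => /Omega_disjoint pq0.
    have : (Omega p `&` Omega q) (row (s p) x) by split; [|rewrite spq].
    by rewrite pq0.
  have := injective_avoid_leq s_inj (fun q => (sP q).1).
  by rewrite ltnNge k_le_m.
have [v Ov] := Omega_nonempty q.
pose x' : 'M[R]_(k, d) := \matrix_l (if l == j then v else row l x).
have cost_x' p : cost x' p <= cost x p.
  have [l [lj lp]] := redundant p; apply: le_trans lp.
  apply: le_trans (inf_le_finite (fun l => min_time F (row l x') (Omega p)) l) _.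
  by rewrite rowK (negbTE lj).
have : objective F Omega x' < objective F Omega x.
  rewrite /objective (bigD1 q)//= [ltRHS](bigD1 q)//=; apply: ltr_leD.
    apply: le_lt_trans cq.
    apply: le_trans (inf_le_finite (fun l => min_time F (row l x') (Omega q)) j) _.
    by rewrite rowK eqxx; exact: min_time_mem.
  by apply: ler_sum => p _; exact: cost_x'.
by rewrite ltNge Sx.
Qed.

(** The competitor has all its components equal to w. *)
Lemma objective_min_le x w : solution_set k F Omega x ->
  objective F Omega x <= \sum_(p < m) min_time F w (Omega p).
Proof.
move=> /(_ (\matrix_(l < k) w)) Sx; apply: le_trans Sx _; apply: ler_sum => p _.
apply: le_trans (inf_le_finite _ (Ordinal k_gt0)) _.
by rewrite rowK.
Qed.

(** The real-valued [sup] bounds the values only once they are known to be bounded, which follows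
    from compactness of the finite union. *)
Lemma min_time_le_sup w v : (\bigcup_p Omega p) v -> min_time F w [set v] <=
  sup [set min_time F w [set v] | v in \bigcup_p Omega p].
Proof.
move=> Ov; apply: ub_le_sup; last by exists v.
have [K KP] : exists K, forall u, (\bigcup_p Omega p) u -> `|u| <= K.
  have /compact_bounded[M [_ OM]] : compact (\bigcup_p Omega p).
    have -> : \bigcup_p Omega p = \bigcup_(p in [set` index_enum 'I_m]) Omega p.
      by apply: eq_bigcupl; split=> p _ //=; rewrite mem_index_enum.
    by rewrite bigcup_seq; exact: bigsetU_compact.
  by exists (M + 1) => u Ou; apply: OM => //; rewrite ltrDl.
exists (set_norm (polar F) * Num.sqrt d%:R * (K + `|w|)) => _ [u Ou <-].
apply: le_trans (min_time_le_norm d_gt0 F_compact F_convex F_int0 w (erefl u)) _.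
rewrite -mulrA ler_wpM2l//; first exact/ltW/normP_gt0.
apply: le_trans (eucl_norm_le_norm _) _; rewrite ler_wpM2l ?sqrtr_ge0//.
by apply: le_trans (ler_normB _ _) _; rewrite lerD2r KP.
Qed.

Lemma solution_enlargement x i w j : solution_set k F Omega x -> Omega i w ->
  enlargement F (Omega i)
    (c ^+ 2 * (\sum_(p < m) min_time F w (Omega p)
      + sup [set min_time F w [set v] | v in \bigcup_p Omega p] / c)) (row j x).
Proof.
move=> Sx Ow; set A := \sum_(p < m) _; set M := sup _.
have c1 : 1 <= c by exact: normFP_ge1.
have c0 : 0 < c by exact: lt_le_trans c1.
have A0 : 0 <= A by apply: sumr_ge0 => p _; exact: min_time_ge0.
have [p jp] := solution_component_serves j Sx.
have jA : min_time F (row j x) (Omega p) <= A.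
  apply: le_trans jp _; apply: le_trans (objective_min_le w Sx).
  rewrite /objective (bigD1 p)//= lerDl; apply: sumr_ge0 => q _.
  exact: cost_ge0.
have xAM : min_time F (row j x) (Omega i) <= A + c * M.
  apply/ler_addgt0Pr => e e0.
  have [t [f [t0 te Ff Of]]] := min_time_adherent d_gt0 F_compact F_convex
    F_int0 (row j x) (Omega_nonempty p) e0.
  apply: le_trans (min_time_add d_gt0 F_compact F_convex F_int0 _ t0 Ff _) _ => //.
  rewrite addrAC; apply: lerD.
    by apply: le_trans (ltW te) _; rewrite lerD2r.
  (* The way from v to w takes at most P ||w - v|| = P ||v - w|| <= P N T_F(w, v), and P N = c. *)
  set v := row j x + t *: f in Of *.
  apply: le_trans (min_time_le_norm d_gt0 F_compact F_convex F_int0 v Ow) _.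
  rewrite /c (mulrC (set_norm F)) -mulrA ler_wpM2l//; first exact/ltW/normP_gt0.
  rewrite eucl_normB.
  apply: le_trans (eucl_norm_le_min_time d_gt0 F_compact F_convex F_int0 w v) _.
  rewrite ler_wpM2l//; first exact/ltW/normF_gt0.
  by apply: min_time_le_sup; exists p.
(* The radius equals c^2 A + c M, and A <= c^2 A since c >= 1. *)
apply: le_trans xAM _; rewrite mulrDr; apply: lerD.
  by rewrite ler_peMl// exprn_ege1.
by rewrite [leRHS](_ : _ = c * M)//; field; rewrite gt_eqF.
Qed.

Lemma compact_solution_set : compact (solution_set k F Omega).
Proof.
pose i := widen_ord k_le_m (Ordinal k_gt0).
have [w Ow] := Omega_nonempty i.
pose r := c ^+ 2 * (\sum_(p < m) min_time F w (Omega p)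
      + sup [set min_time F w [set v] | v in \bigcup_p Omega p] / c).
have [K KP] := compact_eucl_bounded (@Omega_compact i).
have K0 : 0 <= K by apply: le_trans (KP _ Ow); exact: eucl_norm_ge0.
(* Each x^j reaches a point of [Omega i], of norm at most K, in time below r + 1, hence along a
   vector of length at most |r + 1| ||F||. *)
apply: (@bounded_closed_compact_mx _ _ _ _ (K + `|r + 1| * set_norm F)) => [x Sx|];
  last exact: closed_solution_set.
apply: mx_norm_le => [|j l].
  by rewrite addr_ge0 ?mulr_ge0 ?(ltW (normF_gt0 _ _ _ _)).
have := solution_enlargement j Sx Ow; rewrite -/r /enlargement /= => xr.
have [t [f [t0 te Ff Of]]] := min_time_adherent d_gt0 F_compact F_convex
  F_int0 (row j x) (Omega_nonempty i) ltr01.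
have -> : x j l = (row j x + t *: f) 0 l - (t *: f) 0 l by rewrite !mxE addrK.
apply: le_trans (ler_normB _ _) _; apply: lerD.
  apply: le_trans (coord_le_norm _ _ _) _.
  by apply: le_trans (norm_le_eucl_norm _) _; exact: KP.
apply: le_trans (coord_le_norm _ _ _) _; rewrite normrZ; apply: ler_pM => //.
  rewrite ger0_norm//; apply: le_trans (ltW te) _.
  by apply: le_trans (ler_norm _); rewrite lerD2r.
by apply: le_trans (norm_le_eucl_norm _) _; exact: le_normF.
Qed.

End Objective.

Theorem theorem4p9 (R : realType) (d m k : nat) (F : set 'rV[R]_d)
    (Omega : 'I_m -> set 'rV[R]_d)
    (d_ge1 : (1 <= d)%N) (m_ge2 : (2 <= m)%N) (k_ge2 : (2 <= k)%N)
    (k_le_m : (k <= m)%N)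
    (F_compact : compact F) (F_convex : convex_set F)
    (F_int0 : interior F 0)
    (Omega_nonempty : forall i, Omega i !=set0)
    (Omega_compact : forall i, compact (Omega i))
    (Omega_disjoint : forall i p, i != p -> Omega i `&` Omega p = set0) :
  compact (solution_set k F Omega) /\
  (forall (x : 'M[R]_(k, d)) (i : 'I_m) (w : 'rV[R]_d),
     solution_set k F Omega x -> Omega i w ->
     forall j : 'I_k,
       enlargement F (Omega i)
         ((set_norm F * set_norm (polar F)) ^+ 2 *
          (\sum_(p < m) min_time F w (Omega p) +
           sup [set min_time F w [set v] | v in \bigcup_p Omega p]
             / (set_norm F * set_norm (polar F))))
         (row j x)).
Proof.
have k_gt0 : (0 < k)%N by exact: ltnW.
split; first exact: compact_solution_set.
by move=> x i w Sx Ow j; exact: solution_enlargement.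
Qed.
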